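(* For $\boldsymbol{x} = (x_1,\dots,x_n) \in \mathbb{R}^n$, under the constraint that $\sum_{i=1}^n x_i = M$, the range function given by $\max(\boldsymbol{x}) - \min(\boldsymbol{x})$ serves as a relaxation for $\sum_{i=1}^n x_i^2$.
   Context: Here $n$ is a positive integer and $M$ is a real number, both constants; $\max(\boldsymbol{x}) = \max_{1\le i\le n} x_i$ and $\min(\boldsymbol{x}) = \min_{1\le i\le n} x_i$. The word ''relaxation'' is not given a formal definition. It refers to replacing the cost $\sum_{i=1}^n x_i^2$, in a minimization over vectors $\boldsymbol{x}$ satisfying the constraint, by a surrogate cost. The sense in which it is used is as follows: the squared range $(\max(\boldsymbol{x})-\min(\boldsymbol{x}))^2$ is called a relaxation of the cost $\sum_{i=1}^n x_i^2$ because, up to the constants $n$ and $M^2/n$, it bounds that cost from above, i.e. $\sum_{i=1}^n x_i^2 \le n(\max(\boldsymbol{x})-\min(\boldsymbol{x}))^2 + M^2/n$; and since squaring is monotonic on the nonnegative reals, the range $\max(\boldsymbol{x})-\min(\boldsymbol{x})$ itself can be used as the cost to minimize instead of its square. *)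

(* Defs.v *)
From HB Require Import structures.
From mathcomp Require Import all_boot all_order all_algebra.
From mathcomp Require Import classical_sets reals.

Set Implicit Arguments.
Unset Strict Implicit.
Unset Printing Implicit Defensive.

Import Order.TTheory GRing.Theory Num.Theory.

Local Open Scope classical_set_scope.
Local Open Scope ring_scope.

(* The entry of index 0 is the neutral element of the iterated max and min, so
   that both run over the entries of x only; it exists because 0 < n. *)
Definition vec_max (R : realType) (n : nat) (hn : (0 < n)%N) (x : 'rV[R]_n) : R :=
  \big[Num.max/x 0 (Ordinal hn)]_(i < n) x 0 i.

Definition vec_min (R : realType) (n : nat) (hn : (0 < n)%N) (x : 'rV[R]_n) : R :=
  \big[Num.min/x 0 (Ordinal hn)]_(i < n) x 0 i.

Definition vec_range (R : realType) (n : nat) (hn : (0 < n)%N) (x : 'rV[R]_n) : R :=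
  vec_max hn x - vec_min hn x.

Definition sum_constraint (R : realType) (n : nat) (M : R) : set 'rV[R]_n :=
  [set x | \sum_(i < n) x 0 i = M].
Arguments sum_constraint {R} n M.

Definition is_minimizer (R : realType) (T : Type) (S : set T) (f : T -> R) (x : T) : Prop :=
  S x /\ forall y : T, S y -> f x <= f y.

(* Main.v *)
Require Import Defs.
From HB Require Import structures.
From mathcomp Require Import all_boot all_order all_algebra.
From mathcomp Require Import classical_sets reals.
From mathcomp Require Import ring lra.

Set Implicit Arguments.
Unset Strict Implicit.
Unset Printing Implicit Defensive.

Import Order.TTheory GRing.Theory Num.Theory.

Local Open Scope classical_set_scope.
Local Open Scope ring_scope.

(* Let a = M / n be the mean of x.  Then the sum of the x_i^2 is the sum of the
   (x_i - a)^2 plus M^2 / n, and |x_i - a| is at most the range of x because both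
   x_i and a lie between min x and max x. *)

Section Range.
Variables (R : realType) (n : nat) (hn : (0 < n)%N).
Implicit Type x : 'rV[R]_n.

Lemma le_vec_max x i : x 0 i <= vec_max hn x.
Proof. exact: le_bigmax. Qed.

Lemma vec_min_le x i : vec_min hn x <= x 0 i.
Proof. exact: bigmin_le. Qed.

Lemma vec_range_ge0 x : 0 <= vec_range hn x.
Proof.
rewrite subr_ge0.
exact: le_trans (vec_min_le x (Ordinal hn)) (le_vec_max x (Ordinal hn)).
Qed.

Lemma mean_le_vec_max x : (\sum_(i < n) x 0 i) / n%:R <= vec_max hn x.
Proof.
(* After clearing the denominator, [n] times the bound is read as a constant sum over ['I_n], so the
   comparison is termwise. *)
rewrite ler_pdivrMr ?ltr0n // mulr_natr -[X in _ *+ X]card_ord -sumr_const.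
by apply: ler_sum => i _; exact: le_vec_max.
Qed.

Lemma vec_min_le_mean x : vec_min hn x <= (\sum_(i < n) x 0 i) / n%:R.
Proof.
rewrite ler_pdivlMr ?ltr0n // mulr_natr -[X in _ *+ X]card_ord -sumr_const.
by apply: ler_sum => i _; exact: vec_min_le.
Qed.

Lemma sqr_sub_mean_le x i :
  (x 0 i - (\sum_(j < n) x 0 j) / n%:R) ^+ 2 <= vec_range hn x ^+ 2.
Proof.
(* The deviation may be negative, so its square is first written as that of its absolute value;
   squaring is monotone only between nonnegative numbers. *)
rewrite -[leLHS]real_normK ?num_real // lerXn2r ?nnegrE ?vec_range_ge0 //.
have := le_vec_max x i; have := vec_min_le x i.
have := mean_le_vec_max x; have := vec_min_le_mean x.
by rewrite ler_norml /vec_range => *; apply/andP; split; lra.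
Qed.

End Range.

(** On expanding, the cross terms total [- 2 * M ^+ 2 / n%:R] and the constant terms
    [M ^+ 2 / n%:R]; the added term cancels what remains. *)
Lemma sum_sqr_sub_mean (F : numFieldType) (n : nat) (x : 'I_n -> F) :
  (0 < n)%N -> let M := \sum_(i < n) x i in
  \sum_(i < n) x i ^+ 2 = \sum_(i < n) (x i - M / n%:R) ^+ 2 + M ^+ 2 / n%:R.
Proof.
move=> n0 M; have nF : n%:R != 0 :> F by rewrite pnatr_eq0 -lt0n.
under [X in _ = X + _]eq_bigr do rewrite sqrrB.
rewrite big_split sumrB /= sumr_const card_ord sumrMnl -mulr_suml -/M.
rewrite -mulr_natr; field; exact: nF.
Qed.

Theorem mainTheorem1 (R : realType) (n : nat) (hn : (0 < n)%N) (M : R) :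
  (forall x : 'rV[R]_n, sum_constraint n M x ->
     \sum_(i < n) x 0 i ^+ 2 <= n%:R * vec_range hn x ^+ 2 + M ^+ 2 / n%:R)
  /\
  (forall S : set 'rV[R]_n, S `<=` sum_constraint n M ->
     forall x : 'rV[R]_n,
       is_minimizer S (fun y => vec_range hn y) x <->
       is_minimizer S (fun y => vec_range hn y ^+ 2) x).
Proof.
split=> [x <-|S _ x].
  (* The [M ^+ 2 / n%:R] terms cancel, leaving [n] squared deviations against [n] copies of the
     squared range. *)
  rewrite (sum_sqr_sub_mean _ hn) lerD2r mulr_natl -[X in _ <= _ *+ X]card_ord.
  by rewrite -sumr_const; apply: ler_sum => i _; exact: sqr_sub_mean_le.
(* Ranges are nonnegative, so squaring both preserves and reflects their order: the two costs rank
   points identically. *)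
have sqrE y z : (vec_range hn y ^+ 2 <= vec_range hn z ^+ 2) =
    (vec_range hn y <= vec_range hn z).
  by rewrite ler_pXn2r // nnegrE vec_range_ge0.
by split=> -[Sx xmin]; split=> // y /xmin; rewrite sqrE.
Qed.
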